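(* Let $(X,\mathcal{U})$ be a quasi-uniform space, $T\colon X\to X$ a map and $x^*\in X$. The following are equivalent: (i) $U(x^* )\cap U^{-1}(Tx^* )\neq\emptyset$ for every $U\in\mathcal{U}$; (ii) $(x^*,Tx^* )\in\bigcap\mathcal{U}$, i.e. $x^*$ is a $\mathcal{U}$-fixed point of $T$.
   Context: $X$ is a non-empty set. A quasi-uniformity on $X$ is a filter $\mathcal{U}$ on $X\times X$ such that every $U\in\mathcal{U}$ contains the diagonal $\Delta_X$ and for every $U\in\mathcal{U}$ there is $V\in\mathcal{U}$ with $V\circ V\subseteq U$, where $V\circ V=\{(x,z):\exists y,\ (x,y)\in V,\ (y,z)\in V\}$. For $U\in\mathcal{U}$ and $x\in X$: $U(x)=\{y\in X:(x,y)\in U\}$ and $U^{-1}(x)=\{y\in X:(y,x)\in U\}$. $\bigcap\mathcal{U}:=\bigcap_{U\in\mathcal{U}}U$. A point $x_0$ is a $\mathcal{U}$-fixed point of $T\colon X\to X$ if $(x_0,Tx_0)\in\bigcap\mathcal{U}$. *)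

(* Defs.v *)
From mathcomp Require Import all_boot.
From mathcomp Require Import boolp classical_sets filter.

Set Implicit Arguments.
Unset Strict Implicit.
Unset Printing Implicit Defensive.

Local Open Scope classical_set_scope.

(* Since every entourage contains the diagonal, properness of the filter
   amounts to X being non-empty. *)
Record quasi_uniformity (X : Type) (Q : set_system (X * X)) : Prop := {
  quasi_uniformity_filter : ProperFilter Q ;
  quasi_uniformity_diagonal : forall U, Q U -> diagonal `<=` U ;
  quasi_uniformity_split :
    forall U, Q U -> exists2 V, Q V & (V \; V)%relation `<=` U
}.

Definition quasi_fixed_point (X : Type) (Q : set_system (X * X))
    (T : X -> X) (x : X) : Prop :=
  (\bigcap_(U in Q) U) (x, T x).

(* Main.v *)
Require Import Defs.
From mathcomp Require Import all_boot.
From mathcomp Require Import boolp classical_sets filter.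

Local Open Scope classical_set_scope.

(* U(x) is [xsection U x] and U^-1(y) is [ysection U y]. *)
Theorem proposition3p1 (X : Type) (Q : set_system (X * X))
    (hQ : quasi_uniformity Q) (T : X -> X) (xstar : X) :
  (forall U, Q U -> xsection U xstar `&` ysection U (T xstar) !=set0) <->
  quasi_fixed_point Q T xstar.
Proof.
split=> [meets U QU|fixT U QU].
(* The hypothesis is used at a [V] with [V \; V] inside [U], not at [U] itself: a common point [y]
   is a midpoint of two [V]-steps from [xstar] to [T xstar], which compose to one [U]-step. *)
- have [V QV VVU] := quasi_uniformity_split hQ QU.
  have [y [/xsectionP xVy /ysectionP yVT]] := meets V QV.
  by apply: VVU; exists y.
(* The endpoint [T xstar] serves as the midpoint: the first step is the fixed-point condition at
   [U], the second is the trivial one on the diagonal. *)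
- exists (T xstar); split; first by apply/xsectionP; exact: fixT.
  by apply/ysectionP; apply: (quasi_uniformity_diagonal hQ QU).
Qed.
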